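(* Let $N\ge2$ and let $H_1,\dots,H_N$ be nonzero complex Hilbert spaces whose dimensions $n_k=\dim H_k$ satisfy $n_1\le\cdots\le n_N$ and $n_{N-1}<\infty$ ($n_N$ may be infinite). Let $V$ be the set of decomposable unit vectors in $H_1\otimes\cdots\otimes H_N$. Assume that $n_N\ge n_1\cdots n_{N-1}$. Let $\xi_1$ and $\xi_2$ be two maximal vectors in $H_1\otimes\cdots\otimes H_N$. Then there is a unitary operator $U$ in $\mathcal B(H_N)$ such that $$\xi_2=(\mathbf 1_{H_1}\otimes\cdots\otimes\mathbf 1_{H_{N-1}}\otimes U)\xi_1 .$$ Maximal vectors are characterized as the unit vectors $\xi\in H_1\otimes\cdots\otimes H_N$ that purify the tracial state $\tau$ of $\mathcal B(H_1\otimes\cdots\otimes H_{N-1})$, i.e. that satisfy $$\tau(A)=\langle(A\otimes\mathbf 1_{H_N})\xi,\xi\rangle,\qquad A\in\mathcal B(H_1\otimes\cdots\otimes H_{N-1}).$$ Finally, the maximal vectors for $H_1\otimes\cdots\otimes H_N$ are precisely the vectors of the form $$\xi=\frac1{\sqrt{n_1n_2\cdots n_{N-1}}}\bigl(e_1\otimes f_1+\cdots+e_{n_1\cdots n_{N-1}}\otimes f_{n_1\cdots n_{N-1}}\bigr),$$ where $\{e_k:1\le k\le n_1\cdots n_{N-1}\}$ is an orthonormal basis for $H_1\otimes\cdots\otimes H_{N-1}$ and $\{f_k:1\le k\le n_1\cdots n_{N-1}\}$ is an arbitrary orthonormal set in $H_N$.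
   Context: $V=\{\xi_1\otimes\cdots\otimes\xi_N:\xi_k\in H_k,\ \|\xi_1\|=\cdots=\|\xi_N\|=1\}$. With $d(\xi,V)=\inf\{\|\xi-\eta\|:\eta\in V\}$, a maximal vector is a unit vector $\xi$ with $d(\xi,V)=\sup_{\|\eta\|=1}d(\eta,V)$. The tracial state is normalized: $\tau(A)=\operatorname{trace}(A)/(n_1\cdots n_{N-1})$. *)

(* Defs.v *)
From HB Require Import structures.
From mathcomp Require Import all_boot all_order all_algebra.
From mathcomp Require Import complex.
From mathcomp Require Import all_classical all_reals all_analysis.

Set Implicit Arguments.
Unset Strict Implicit.
Unset Printing Implicit Defensive.

Import Order.TTheory GRing.Theory Num.Theory numFieldNormedType.Exports.

Local Open Scope classical_set_scope.
Local Open Scope ring_scope.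

(* The inner product is linear in its first argument. *)
HB.mixin Record CompleteNormedModule_isHilbert (R : realType) T
    of CompleteNormedModule R[i] T := {
  hdot : {dot T for (@Num.conj R[i])};
  hdot_norm : forall x : T, hdot x x = `|x| ^+ 2
}.

#[short(type="hilbertType")]
HB.structure Definition Hilbert (R : realType) :=
  {T of CompleteNormedModule R[i] T & CompleteNormedModule_isHilbert R T}.

Notation "''[' x , y ]" := (hdot x y) : ring_scope.

Section Hilbert.
Variable R : realType.
Implicit Types H K T : hilbertType R.

(* The norm of a [normedModType R[i]] takes values in [R[i]]. *)
Definition hnorm H (x : H) : R := complex.Re `|x|.

Definition orthonormal_family H k (e : 'I_k -> H) : Prop :=
  forall i j, '[e i, e j] = (i == j)%:R.

Definition orthonormal_basis H k (e : 'I_k -> H) : Prop :=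
  orthonormal_family e /\ forall x, exists c : 'I_k -> R[i],
    x = \sum_i c i *: e i.

(* Dimensions are finite or infinite, [None] standing for the latter:
   infinite cardinals need not be distinguished. *)
Definition has_dim H (n : option nat) : Prop :=
  if n is Some k then exists e : 'I_k -> H, orthonormal_basis e
  else forall k, ~ exists e : 'I_k -> H, orthonormal_basis e.

Definition leq_dim (k : nat) (n : option nat) : bool :=
  if n is Some l then (k <= l)%N else true.

Definition bounded_operator H K (A : H -> K) : Prop :=
  linear A /\ exists M : R, forall x, hnorm (A x) <= M * hnorm x.

Definition unitary_operator H (U : H -> H) : Prop :=
  bounded_operator U /\ exists2 Ustar : H -> H, bounded_operator Ustar &
    [/\ forall x y, '[U x, y] = '[x, Ustar y],
        cancel U Ustar & cancel Ustar U].

(* Meant for [H] of finite dimension, where the value does not depend on the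
   orthonormal basis [e]. *)
Definition trace H (A : H -> H) : R[i] :=
  xget 0 [set z | exists k, exists2 e : 'I_k -> H, orthonormal_basis e &
                  z = \sum_i '[A (e i), e i]].

(* [T], with [t x] in the role of the decomposable vector
   x_1 (x) ... (x) x_N, is the Hilbert space tensor product of the [H i].
   These properties determine ([T], [t]) up to a unique unitary operator. *)
Record hilbert_tensor (I : finType) (H : I -> hilbertType R) T
    (t : (forall i, H i) -> T) : Prop := {
  htensor_multilinear : forall (x : forall i, H i) (i : I) (a : R[i])
    (u v : H i), t (dfwith x i (a *: u + v)) =
                 a *: t (dfwith x i u) + t (dfwith x i v);
  htensor_dot : forall x y, '[t x, t y] = \prod_i '[x i, y i];
  htensor_dense : dense [set z | exists k (c : 'I_k -> R[i])
    (x : 'I_k -> forall i, H i), z = \sum_j c j *: t (x j)]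
}.

Record hilbert_tensor2 H K T (b : {bilinear H -> K -> T}) : Prop := {
  htensor2_dot : forall x x' y y', '[b x y, b x' y'] = '[x, x'] * '[y, y'];
  htensor2_dense : dense [set z | exists k (c : 'I_k -> R[i])
    (x : 'I_k -> H) (y : 'I_k -> K), z = \sum_j c j *: b (x j) (y j)]
}.

(* Tensor products of bounded operators.  There is exactly one operator in
   the sets below when the tensor factors [A] (and [B]) are bounded. *)
Definition tensor_op (I : finType) (H : I -> hilbertType R) T
    (t : (forall i, H i) -> T) (A : forall i, H i -> H i) : T -> T :=
  xget (fun=> 0) [set C : T -> T | bounded_operator C /\
    forall x, C (t x) = t (fun i => A i (x i))].

Definition tensor2_op H K T (b : {bilinear H -> K -> T})
    (A : H -> H) (B : K -> K) : T -> T :=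
  xget (fun=> 0) [set C : T -> T | bounded_operator C /\
    forall x y, C (b x y) = b (A x) (B y)].

Definition decomposable_unit (I : finType) (H : I -> hilbertType R) T
    (t : (forall i, H i) -> T) : set T :=
  [set t x | x in [set x | forall i, hnorm (x i) = 1]].

Definition dist H (x : H) (V : set H) : R :=
  inf [set hnorm (x - v) | v in V].

Definition maximal_vector H (V : set H) (x : H) : Prop :=
  hnorm x = 1 /\
  dist x V = sup [set dist y V | y in [set y : H | hnorm y = 1]].

End Hilbert.

(* Main.v *)
(* For a vector xi of T' (x) H_N let S w, for w in T', be the vector of H_N with
   <xi, w (x) y> = <S w, y>; S is conjugate linear, and xi = sum_k e_k (x) S e_k
   for every orthonormal basis e of T'.  For a unit vector xi one has
   d(xi, V)^2 = 2 - 2 m, where m is the supremum of |S w| over the decomposable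
   unit vectors w of T'.  The squares |S w|^2 add up to 1 over an orthonormal
   basis of p decomposable vectors, so that m is at least 1/sqrt p.  Each
   decomposable unit vector belongs to such a basis, hence m = 1/sqrt p only if
   |S w|^2 = 1/p for all of them; polarizing in one variable at a time, sqrt p S
   is then antiunitary onto its range.  This says that the vectors sqrt p S e_k are
   orthonormal, and also that xi purifies the tracial state.  Two orthonormal
   families of p vectors of H_N are exchanged by a product of Householder
   reflections. *)
Require Import Defs.
From mathcomp Require Import all_boot all_order all_algebra.
From mathcomp Require Import complex.
From mathcomp Require Import all_classical all_reals all_analysis.
From mathcomp Require Import ring lra.

Set Implicit Arguments.
Unset Strict Implicit.
Unset Printing Implicit Defensive.

Import Order.TTheory GRing.Theory Num.Theory numFieldNormedType.Exports.

Local Open Scope classical_set_scope.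
Local Open Scope ring_scope.

(** * Orthonormal families *)

Section InnerProduct.
Variables (R : realType) (H : hilbertType R).
Implicit Types (x y z u v w : H) (a c : R[i]) (J : finType).

Lemma dotC x y : '[x, y] = '[y, x]^*.
Proof. by rewrite (hermC hdot) expr0 mul1r. Qed.

Lemma dotDl x y z : '[x + y, z] = '[x, z] + '[y, z].
Proof. exact: (linearDl hdot). Qed.

Lemma dotDr x y z : '[x, y + z] = '[x, y] + '[x, z].
Proof. exact: (linearDr hdot). Qed.

Lemma dotBl x y z : '[x - y, z] = '[x, z] - '[y, z].
Proof. exact: (linearBl hdot). Qed.

Lemma dotBr x y z : '[x, y - z] = '[x, y] - '[x, z].
Proof. exact: (linearBr hdot). Qed.

Lemma dotNl x y : '[- x, y] = - '[x, y].
Proof. exact: (linearNl hdot). Qed.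

Lemma dotNr x y : '[x, - y] = - '[x, y].
Proof. exact: (linearNr hdot). Qed.

Lemma dotZl a x y : '[a *: x, y] = a * '[x, y].
Proof. exact: (linearZl_LR hdot). Qed.

Lemma dotZr a x y : '[x, a *: y] = a^* * '[x, y].
Proof. exact: (linearZr_LR hdot). Qed.

Lemma dot0l x : '[0, x] = 0.
Proof. exact: (linear0l hdot). Qed.

Lemma dot0r x : '[x, 0] = 0.
Proof. exact: (linear0r hdot). Qed.

Lemma dot_suml J (F : J -> H) x : '[\sum_j F j, x] = \sum_j '[F j, x].
Proof. exact: (linear_sumlz hdot). Qed.

Lemma dot_sumr J (F : J -> H) x : '[x, \sum_j F j] = \sum_j '[x, F j].
Proof. exact: (linear_sumr hdot). Qed.

Definition dotE := (dotDl, dotDr, dotBl, dotBr, dotNl, dotNr, dotZl, dotZr).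

Lemma dot_ge0 x : 0 <= '[x, x].
Proof. by rewrite hdot_norm exprn_ge0. Qed.

Lemma dot_eq0 x : '[x, x] = 0 -> x = 0.
Proof. by move/eqP; rewrite hdot_norm sqrf_eq0 normr_eq0 => /eqP. Qed.

Lemma dot_inj x y : (forall z, '[x, z] = '[y, z]) -> x = y.
Proof.
by move=> xy; apply/eqP; rewrite -subr_eq0; apply/eqP/dot_eq0; rewrite dotBl xy subrr.
Qed.

Lemma hnormE x : (hnorm x)%:C%C = `|x|.
Proof. by rewrite /hnorm RRe_real// ger0_real. Qed.

Lemma hnorm_ge0 x : 0 <= hnorm x.
Proof. by rewrite -(ler0c (hnorm x)) hnormE. Qed.

Lemma hnorm_sq x : (hnorm x ^+ 2)%:C%C = '[x, x].
Proof. by rewrite hdot_norm -hnormE rmorphXn. Qed.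

Lemma Re_dot x : complex.Re '[x, x] = hnorm x ^+ 2.
Proof. by rewrite -hnorm_sq. Qed.

Lemma hnorm1P x : hnorm x = 1 <-> '[x, x] = 1.
Proof.
rewrite -hnorm_sq; split=> [->|/complexI/eqP]; first by rewrite expr1n.
by rewrite sqrp_eq1 ?hnorm_ge0// => /eqP.
Qed.

(** Translates distances between unit vectors into real parts of inner products, so that being far
    from [V] means having small overlaps with it. *)
Lemma hnormB_unit x y : hnorm x = 1 -> hnorm y = 1 ->
  hnorm (x - y) ^+ 2 = 2 - 2 * complex.Re '[x, y].
Proof.
move=> /hnorm1P x1 /hnorm1P y1; rewrite -Re_dot !dotE x1 y1 [in '[y, x]]dotC.
by case: '[x, y] => p q /=; lra.
Qed.

Lemma dot_normalized x : x != 0 -> '[(`|x|)^-1 *: x, (`|x|)^-1 *: x] = 1.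
Proof.
move=> x0; rewrite dotZl dotZr hdot_norm.
have -> : (`|x|^-1)^* = `|x|^-1 by apply/CrealP; rewrite rpredV ger0_real.
by rewrite mulrA -expr2 exprVn mulVf// sqrf_eq0 normr_eq0.
Qed.

Definition orthonormal_on J (e : J -> H) := forall i j, '[e i, e j] = (i == j)%:R.

(** The index type is any finite type, so that product bases can be indexed by choice functions, and
    the coefficients are made explicit. *)
Definition onb J (e : J -> H) :=
  orthonormal_on e /\ forall x, x = \sum_i '[x, e i] *: e i.

Lemma orthonormal_coef J (e : J -> H) (c : J -> R[i]) j : orthonormal_on e ->
  '[\sum_i c i *: e i, e j] = c j.
Proof.
move=> oe; rewrite dot_suml (bigD1 j)//= dotZl oe eqxx mulr1 big1 ?addr0// => i ij.
by rewrite dotZl oe (negbTE ij) mulr0.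
Qed.

Lemma orthonormal_basisP k (e : 'I_k -> H) : orthonormal_basis e <-> onb e.
Proof.
split=> -[oe se]; split=> // x; last by exists (fun i => '[x, e i]).
have [c ->] := se x.
by apply: eq_bigr => i _; rewrite orthonormal_coef.
Qed.

(** Pythagoras for the residual [y] of the projection of [x]. Equality in Bessel's inequality then
    puts [x] in the span, and residuals never exceed [x] in norm. *)
Lemma bessel_id J (e : J -> H) x : orthonormal_on e ->
  let y := x - \sum_i '[x, e i] *: e i in
  '[y, y] = '[x, x] - \sum_i '[x, e i] * '[e i, x].
Proof.
move=> oe; set s := \sum_i _ => /=.
have sx : '[s, x] = \sum_i '[x, e i] * '[e i, x].
  by rewrite dot_suml; apply: eq_bigr => i _; rewrite dotZl.
have xs : '[x, s] = \sum_i '[x, e i] * '[e i, x].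
  by rewrite dot_sumr; apply: eq_bigr => i _; rewrite dotZr -dotC mulrC.
have ss : '[s, s] = \sum_i '[x, e i] * '[e i, x].
  rewrite {2}/s dot_sumr; apply: eq_bigr => i _.
  by rewrite dotZr orthonormal_coef// -dotC mulrC.
by rewrite !dotE sx xs ss; ring.
Qed.

Lemma bessel_eq J (e : J -> H) x : orthonormal_on e ->
  '[x, x] = \sum_i '[x, e i] * '[e i, x] -> x = \sum_i '[x, e i] *: e i.
Proof.
move=> oe xx; apply/eqP; rewrite -subr_eq0; apply/eqP/dot_eq0.
by rewrite bessel_id// {1}xx subrr.
Qed.

Lemma bessel_le J (e : J -> H) x : orthonormal_on e ->
  `|x - \sum_i '[x, e i] *: e i| <= `|x|.
Proof.
move=> oe; rewrite -(@ler_pXn2r _ 2)// ?nnegrE// -!hdot_norm bessel_id//.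
rewrite gerBl; apply: sumr_ge0 => i _; rewrite [in '[e i, x]]dotC.
exact: mul_conjC_ge0.
Qed.

Lemma parseval J (e : J -> H) x y : onb e ->
  '[x, y] = \sum_i '[x, e i] * '[e i, y].
Proof.
by case=> _ se; rewrite {1}(se x) dot_suml; apply: eq_bigr => i _; rewrite dotZl.
Qed.

Lemma onb_reindex J J' (h : J' -> J) (e : J -> H) : bijective h ->
  onb e -> onb (e \o h).
Proof.
move=> hb [oe se]; split=> [i j|x] /=; first by rewrite oe (bij_eq hb).
by rewrite {1}(se x) (reindex h) //; apply: onW_bij.
Qed.

End InnerProduct.

(** * Linear operators, the trace and Householder reflections *)

Section Operators.
Variable R : realType.
Implicit Types (H K : hilbertType R).

Lemma linear_propD H K (A : H -> K) : linear A -> {morph A : x y / x + y}.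
Proof. by move=> lA x y; have := lA 1 x y; rewrite !scale1r. Qed.

Lemma linear_prop0 H K (A : H -> K) : linear A -> A 0 = 0.
Proof.
by move=> lA; apply: (addrI (A 0)); rewrite -(linear_propD lA) !addr0.
Qed.

Lemma linear_propZ H K (A : H -> K) : linear A -> forall c x, A (c *: x) = c *: A x.
Proof. by move=> lA c x; have := lA c x 0; rewrite (linear_prop0 lA) !addr0. Qed.

Lemma linear_propB H K (A : H -> K) : linear A -> {morph A : x y / x - y}.
Proof.
by move=> lA x y; rewrite -scaleN1r addrC lA scaleN1r addrC.
Qed.

Lemma linear_prop_sum H K (A : H -> K) (J : finType) (F : J -> H) : linear A ->
  A (\sum_j F j) = \sum_j A (F j).
Proof.
by move=> lA; apply: (big_morph A (linear_propD lA) (linear_prop0 lA)).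
Qed.

(** [trace] selects some orthonormal basis by [xget]. Expanding that basis in [e], exchanging the
    sums and applying Parseval shows that the choice does not matter. *)
Lemma trace_onb H k (e : 'I_k -> H) (A : H -> H) : onb e -> linear A ->
  trace A = \sum_i '[A (e i), e i].
Proof.
move=> be lA; rewrite /trace.
case: xgetP => [y _|/(_ (\sum_i '[A (e i), e i]))]; last first.
  by case; exists k, e => //; apply/orthonormal_basisP.
case=> k' [e' /orthonormal_basisP be' ->] /=.
transitivity (\sum_i \sum_j '[e' i, e j] * '[A (e j), e' i]).
  apply: eq_bigr => i _; rewrite {1}(be.2 (e' i)) (linear_prop_sum _ lA) dot_suml.
  by apply: eq_bigr => j _; rewrite (linear_propZ lA) dotZl.
rewrite exchange_big; apply: eq_bigr => j _ /=.
rewrite (parseval (A (e j)) (e j) be'); apply: eq_bigr => i _.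
by rewrite mulrC.
Qed.

(* The Householder reflection taking the unit vector [u] to the unit vector [v];
   if [u = v] then the quotient is 0 / 0 = 0. *)
Definition reflector H (u v x : H) : H := x - ('[x, u - v] / '[u, u - v]) *: (u - v).

Lemma reflector_linear H (u v : H) : linear (reflector u v).
Proof.
move=> c x y; rewrite /reflector; move: (u - v) => w.
by rewrite dotDl dotZl mulrDl scalerDl -mulrA scalerBr -scalerA opprD addrACA.
Qed.

Lemma reflector_orth H (u v x : H) : '[x, u] = 0 -> '[x, v] = 0 -> reflector u v x = x.
Proof. by move=> xu xv; rewrite /reflector dotBr xu xv subrr mul0r scale0r subr0. Qed.

Section Reflector.
Variables (H : hilbertType R) (u v : H).
Hypotheses (u1 : '[u, u] = 1) (v1 : '[v, v] = 1).

Let dotvw : '[v, u - v] = - '[u, u - v]^*.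
Proof. by rewrite !dotBr u1 v1 rmorphB/= rmorph1 -dotC opprB. Qed.

Let dotww : '[u - v, u - v] = '[u, u - v] + '[u, u - v]^*.
Proof. by rewrite {1}dotBl dotvw opprK. Qed.

(** The number <u, u - v> need not be real, so a reflector need not be an involution. Exchanging [u]
    and [v] conjugates the denominator, which makes [reflector v u] both adjoint and inverse to
    [reflector u v]. *)
Let reflector_inv x : reflector v u x = x - ('[x, u - v] / '[u, u - v]^*) *: (u - v).
Proof.
rewrite /reflector -[v - u]opprB !dotNr dotvw; move: (u - v) => w.
by rewrite opprK scalerN mulNr scaleNr opprK.
Qed.

Lemma reflectorE : reflector u v u = v.
Proof.
rewrite /reflector; have [c0|c0] := eqVneq '[u, u - v] 0.
  suff -> : v = u by rewrite subrr scaler0 subr0.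
  apply/esym/eqP; rewrite -subr_eq0; apply/eqP/dot_eq0.
  by rewrite dotww c0 rmorph0 addr0.
by rewrite divff// scale1r opprB addrC subrK.
Qed.

Lemma reflector_adjoint x y : '[reflector u v x, y] = '[x, reflector v u y].
Proof.
rewrite reflector_inv /reflector; move: (u - v) => w.
by rewrite dotBl dotBr dotZl dotZr rmorphM/= fmorphV/= conjCK -dotC; ring.
Qed.

Lemma reflectorK : cancel (reflector u v) (reflector v u).
Proof.
move=> x; rewrite reflector_inv /reflector; move: dotww; move: (u - v) => w ww.
rewrite -addrA -opprD -scalerDl dotBl dotZl ww.
have [c0|c0] := eqVneq '[u, w] 0.
  by rewrite c0 rmorph0 invr0 !mulr0 addr0 scale0r subr0.
have cc0 : '[u, w]^* != 0 by rewrite conjC_eq0.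
rewrite [X in X *: _](_ : _ = 0) ?scale0r ?subr0//.
by field; rewrite c0 cc0.
Qed.

End Reflector.

(** Boundedness comes for free: an operator whose adjoint is its inverse is isometric. *)
Lemma unitary_intro H (U U' : H -> H) : linear U -> linear U' ->
  (forall x y, '[U x, y] = '[x, U' y]) -> cancel U U' -> cancel U' U ->
  unitary_operator U.
Proof.
move=> lU lU' adj UK UK'.
have bounded_iso (A : H -> H) : linear A -> (forall x, '[A x, A x] = '[x, x]) ->
    bounded_operator A.
  move=> lA iA; split=> //; exists 1 => x; rewrite mul1r.
  by rewrite -(@ler_pXn2r _ 2)// ?nnegrE ?hnorm_ge0// -!Re_dot iA.
split; first by apply: bounded_iso => // x; rewrite adj UK.
exists U' => //; apply: bounded_iso => // x.
by rewrite -adj UK'.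
Qed.

Lemma unitary_linear H (U : H -> H) : unitary_operator U -> linear U.
Proof. by case=> -[]. Qed.

Lemma unitary_comp H (U V : H -> H) :
  unitary_operator U -> unitary_operator V -> unitary_operator (U \o V).
Proof.
move=> [[lU _] [U' [lU' _] [adjU UK UK']]] [[lV _] [V' [lV' _] [adjV VK VK']]].
apply: (@unitary_intro _ _ (V' \o U')).
- by move=> c x y /=; rewrite lV lU.
- by move=> c x y /=; rewrite lU' lV'.
- by move=> x y /=; rewrite adjU adjV.
- exact: can_comp.
- exact: can_comp.
Qed.

Lemma unitary_id H : unitary_operator (@idfun H).
Proof. by apply: (@unitary_intro _ _ idfun). Qed.

Lemma unitary_reflector H (u v : H) : '[u, u] = 1 -> '[v, v] = 1 ->
  unitary_operator (reflector u v).
Proof.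
move=> u1 v1; apply: (@unitary_intro _ _ (reflector v u)).
- exact: reflector_linear.
- exact: reflector_linear.
- exact: reflector_adjoint.
- exact: reflectorK.
- exact: reflectorK.
Qed.

Lemma unitary_dot H (U : H -> H) : unitary_operator U ->
  forall x y, '[U x, U y] = '[x, y].
Proof. by case=> _ [U' _ [adj UK _]] x y; rewrite adj UK. Qed.

Lemma unitary_onb H (J : finType) (U : H -> H) (e : J -> H) :
  unitary_operator U -> onb e -> onb (U \o e).
Proof.
move=> uU [oe se]; split=> [i j|x] /=; first by rewrite unitary_dot.
have lU := unitary_linear uU; have [_ [U' _ [adj UK UK']]] := uU.
rewrite -{1}(UK' x) {1}(se (U' x)) (linear_prop_sum _ lU); apply: eq_bigr => i _.
by rewrite (linear_propZ lU) -{2}(UK' x) unitary_dot.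
Qed.

Lemma onb_through_unit H (J : finType) (e : J -> H) (x : H) (j : J) : onb e ->
  '[x, x] = 1 -> exists2 e' : J -> H, onb e' & e' j = x.
Proof.
move=> be x1; have e1 : '[e j, e j] = 1 by rewrite be.1 eqxx.
exists (reflector (e j) x \o e); last exact: reflectorE.
by apply: unitary_onb => //; apply: unitary_reflector.
Qed.

Lemma unitary_extension H k (f g : 'I_k -> H) :
  orthonormal_family f -> orthonormal_family g ->
  exists2 U : H -> H, unitary_operator U & forall i, U (f i) = g i.
Proof.
elim: k f g => [|k IHk] f g of_ og.
  by exists idfun => [|[]//]; exact: unitary_id.
have [i j||U uU Uf] := IHk (f \o lift ord_max) (g \o lift ord_max).
- by rewrite /= of_ (inj_eq lift_inj).
- by move=> i j; rewrite /= og (inj_eq lift_inj).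
have u1 : '[U (f ord_max), U (f ord_max)] = 1 by rewrite unitary_dot// of_ eqxx.
have v1 : '[g ord_max, g ord_max] = 1 by rewrite og eqxx.
exists (reflector (U (f ord_max)) (g ord_max) \o U) => [|i].
  by apply: unitary_comp => //; apply: unitary_reflector.
rewrite /=; case: (unliftP ord_max i) => [j|] ->; last exact: reflectorE.
have {}Uf : U (f (lift ord_max j)) = g (lift ord_max j) := Uf j.
(* The last reflector keeps the vectors already in place: they are orthogonal to [g ord_max], and to
   [U (f ord_max)] because [U] preserves inner products. *)
rewrite Uf; apply: reflector_orth; last by rewrite og eq_sym (negbTE (neq_lift _ _)).
by rewrite -Uf unitary_dot// of_ eq_sym (negbTE (neq_lift _ _)).
Qed.

(** Gram-Schmidt: a family of [k] vectors is not a basis, so some [x] has a nonzero residual, which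
    after normalization extends the family. *)
Lemma orthonormal_family_infinite_dim H : has_dim H None ->
  forall k, exists f : 'I_k -> H, orthonormal_family f.
Proof.
move=> infH; elim=> [|k [f of_]]; first by exists (fun=> 0) => -[].
have [x xf] : exists x, x != \sum_i '[x, f i] *: f i.
  apply: contrapT => /forallNP nx; apply: (infH k); exists f.
  apply/orthonormal_basisP; split=> // x.
  by have /negP := nx x; rewrite negbK => /eqP.
pose y := x - \sum_i '[x, f i] *: f i.
have y0 : y != 0 by rewrite subr_eq0.
have yf i : '[y, f i] = 0 by rewrite dotBl orthonormal_coef// subrr.
pose z := `|y|^-1 *: y.
have zf i : '[z, f i] = 0 by rewrite dotZl yf mulr0.
exists (fun i => if unlift ord_max i is Some j then f j else z) => i j.
case: (unliftP ord_max i) => [i'|] ->; case: (unliftP ord_max j) => [j'|] ->.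
- by rewrite (inj_eq lift_inj) of_.
- by rewrite dotC zf rmorph0 eq_sym (negbTE (neq_lift _ _)).
- by rewrite zf (negbTE (neq_lift _ _)).
- by rewrite eqxx dot_normalized.
Qed.

Lemma orthonormal_family_dim H (n : option nat) k : has_dim H n -> leq_dim k n ->
  exists f : 'I_k -> H, orthonormal_family f.
Proof.
case: n => [l|] /= dimH lek; last exact: orthonormal_family_infinite_dim.
have [e [oe _]] := dimH; exists (e \o widen_ord lek) => i j /=.
by rewrite oe -!val_eqE.
Qed.

End Operators.

(** * Orthonormal bases of tensor products *)

Section Density.
Variable R : realType.
Implicit Types (H : hilbertType R) (J : finType).

Lemma dense_approx H (S : set H) (x : H) (eps : R[i]) : dense S -> 0 < eps ->
  exists2 z, S z & `|x - z| < eps.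
Proof.
move=> dS eps0; have [||z [xz Sz]] := dS (ball x eps).
- by exists x; exact: ballxx.
- exact: ball_open.
- by exists z => //; move: xz; rewrite -ball_normE.
Qed.

(** A positive element of [R[i]] is real, so the Archimedean property of [R] applies. *)
Lemma complex_invS_lt (eps : R[i]) : 0 < eps -> exists N : nat, N.+1%:R^-1 < eps.
Proof.
move=> eps0; have epsE : eps = (complex.Re eps)%:C%C.
  by rewrite RRe_real// gtr0_real.
move: eps0; rewrite epsE ltcR => /ltr_add_invr[N]; rewrite add0r => Nlt.
by exists N; rewrite -(rmorph_nat (real_complex R)) -fmorphV ltcR.
Qed.

Lemma proj_linear H J (e : J -> H) : linear (fun x => \sum_j '[x, e j] *: e j).
Proof.
move=> c x y; rewrite scaler_sumr -big_split; apply: eq_bigr => j _ /=.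
by rewrite dotDl dotZl scalerDl scalerA.
Qed.

(** Let P be the projection onto the span of [e]. If x differed from P x, some z in [S] would
    satisfy |x - z| < |x - P x|. But P z = z, so Bessel bounds |x - P x| = |(x - z) - P (x - z)| by
    |x - z|. *)
Lemma onb_dense H J (e : J -> H) (S : set H) : orthonormal_on e -> dense S ->
  (forall z, S z -> z = \sum_j '[z, e j] *: e j) -> onb e.
Proof.
move=> oe dS Se; split=> // x; pose P x := \sum_j '[x, e j] *: e j.
apply: contrapT => /eqP; rewrite -subr_eq0 -normr_gt0 => /(dense_approx x dS)[z Sz].
move=> lt; have := bessel_le (x - z) oe.
rewrite [X in _ - X](_ : _ = P x - z) ?opprB ?addrA ?subrK; last first.
  by rewrite {2}(Se z Sz) (linear_propB (proj_linear e)).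
by move=> /le_lt_trans /(_ lt); rewrite ltxx.
Qed.
End Density.

(** Distributivity when the index type varies with the factor; the proof passes through the tagged
    union of the [J_ i]. *)
Lemma prod_sum_fprod (C : comPzSemiRingType) (I : finType) (J_ : I -> finType)
    (F : forall i, J_ i -> C) :
  \prod_i \sum_(k : J_ i) F i k = \sum_(phi : fprod J_) \prod_i F i (phi i).
Proof.
pose P i := [ffun k => F i k].
transitivity (\sum_(phi : fprod J_) \prod_(i in I) P i (phi i)); last first.
  by apply: eq_bigr => phi _; apply: eq_bigr => i _; rewrite ffunE.
rewrite big_fprod.
transitivity (\prod_i \sum_(k in tagged_with J_ i) untag 0 (P i) k).
  apply: eq_bigr => i _; rewrite -(big_tag (fun i => P i)).
  by apply: eq_bigr => k _; rewrite ffunE.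
by rewrite bigA_distr_big_dep.
Qed.

Section ProductBasis.
Variables (R : realType) (I : finType) (H : I -> hilbertType R) (T : hilbertType R).
Variables (t : (forall i, H i) -> T) (ht : hilbert_tensor t).

Lemma tensor_scale (c : I -> R[i]) (x : forall i, H i) :
  t (fun i => c i *: x i) = (\prod_i c i) *: t x.
Proof.
have cl (y z : forall i, H i) :
    '[t (fun i => c i *: y i), t z] = (\prod_i c i) * '[t y, t z].
  by rewrite !(htensor_dot ht) -big_split; apply: eq_bigr => i _; rewrite dotZl.
have cr (y z : forall i, H i) :
    '[t z, t (fun i => c i *: y i)] = (\prod_i c i)^* * '[t z, t y].
  by rewrite dotC cl rmorphM/= -dotC.
apply/eqP; rewrite -subr_eq0; apply/eqP/dot_eq0.
by rewrite !dotE !(cl, cr); ring.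
Qed.

Lemma tensor_unit (x : forall i, H i) : (forall i, '[x i, x i] = 1) ->
  '[t x, t x] = 1.
Proof. by move=> x1; rewrite (htensor_dot ht) big1. Qed.

Lemma onb_tensor (J_ : I -> finType) (e : forall i, J_ i -> H i) :
  (forall i, onb (e i)) -> onb (fun phi : fprod J_ => t (fun i => e i (phi i))).
Proof.
move=> be; set E := fun phi : fprod J_ => _.
have oE : orthonormal_on E.
  move=> phi psi; rewrite (htensor_dot ht); have [<-|ne] := eqVneq phi psi.
    by rewrite big1// => i _; rewrite (be i).1 eqxx.
  have [i /eqP ni] : exists i, phi i <> psi i.
    by apply/existsNP => /fprodP; apply/eqP.
  by rewrite (bigD1 i)//= (be i).1 (negbTE ni) mul0r.
apply: (onb_dense oE (htensor_dense ht)) => z [k [c [x ->]]].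
rewrite (linear_prop_sum _ (proj_linear E)); apply: eq_bigr => j _.
rewrite (linear_propZ (proj_linear E)); congr (_ *: _).
(* A decomposable vector lies in the span because the product of the Parseval identities of the
   factors is Parseval's identity for [E]. *)
apply: (bessel_eq oE); rewrite (htensor_dot ht).
under eq_bigr => i _ do rewrite (parseval _ _ (be i)).
rewrite prod_sum_fprod; apply: eq_bigr => phi _.
by rewrite big_split/= /E !(htensor_dot ht).
Qed.

(** Expanding B (c u + v) (c u + v) = 0 leaves c B u v + c^* B v u = 0. Taking c = 1 and c = i gives
    B v u = - B u v and B v u = B u v. *)
Lemma sesquilinear_diag0 (V : lmodType R[i]) (B : V -> V -> R[i]) :
  (forall c u v w, B (c *: u + v) w = c * B u w + B v w) ->
  (forall c u v w, B w (c *: u + v) = c^* * B w u + B w v) ->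
  (forall u, B u u = 0) -> forall u v, B u v = 0.
Proof.
move=> Bl Br B0 u v.
have polar c : c * B u v + c^* * B v u = 0.
  by have := B0 (c *: u + v); rewrite Bl !Br !B0 mulr0 add0r addr0.
have := polar 1; have := polar 'i; rewrite conjCi rmorph1 !mul1r mulNr -mulrBr => /eqP.
rewrite mulf_eq0 (negbTE (neq0Ci _)) subr_eq0/= => /eqP <- /eqP.
by rewrite -mulr2n mulrn_eq0/= => /eqP.
Qed.

(* Polarization in one variable at a time. *)
Lemma tensor_polarization (Q : T -> T -> R[i]) :
  (forall c u v w, Q (c *: u + v) w = c * Q u w + Q v w) ->
  (forall c u v w, Q w (c *: u + v) = c^* * Q w u + Q w v) ->
  (forall x, Q (t x) (t x) = 0) -> forall x y, Q (t x) (t y) = 0.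
Proof.
move=> Ql Qr Q0.
(* Induction on a list [s] of indices outside which [x] and [y] agree. On the diagonal of the form
   in the variable [i], the two families agree at [i] too, which shortens the list. *)
suff Qs (s : seq I) x y : (forall i, i \notin s -> x i = y i) -> Q (t x) (t y) = 0.
  by move=> x y; apply: (Qs (enum I)) => i; rewrite mem_enum.
elim: s x y => [|i s IHs] x y xy.
  have -> : x = y by apply: functional_extensionality_dep => i; apply: xy.
  exact: Q0.
have dfwithE (z : forall i, H i) : dfwith z i (z i) = z.
  apply: functional_extensionality_dep => j.
  by have [<-|ij] := eqVneq i j; rewrite ?dfwithin// dfwithout.
rewrite -[x]dfwithE -[y]dfwithE.
apply: (sesquilinear_diag0 (B := fun u v => Q (t (dfwith x i u)) (t (dfwith y i v)))).
- by move=> c u v w; rewrite (htensor_multilinear ht) Ql.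
- by move=> c u v w; rewrite (htensor_multilinear ht) Qr.
- move=> u; apply: IHs => j js; have [<-|ij] := eqVneq i j; first by rewrite !dfwithin.
  by rewrite !dfwithout// xy// inE negb_or eq_sym ij.
Qed.

End ProductBasis.

(** * Slices of a vector of a tensor product *)

Section Tensor2.
Variables (R : realType) (W K T : hilbertType R) (b : {bilinear W -> K -> T}).
Hypothesis hb : hilbert_tensor2 b.

Section Basis.
Variables (J : finType) (e : J -> W).
Hypothesis be : onb e.

Lemma tensor2_sum_dot (g h : J -> K) :
  '[\sum_j b (e j) (g j), \sum_j b (e j) (h j)] = \sum_j '[g j, h j].
Proof.
rewrite dot_suml; apply: eq_bigr => j _; rewrite dot_sumr (bigD1 j)//= big1.
  by rewrite (htensor2_dot hb) be.1 eqxx mul1r addr0.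
by move=> k kj; rewrite (htensor2_dot hb) be.1 eq_sym (negbTE kj) mul0r.
Qed.

Lemma tensor2_coef_le (g : J -> K) j : `|g j| <= `|\sum_j b (e j) (g j)|.
Proof.
rewrite -(@ler_pXn2r _ 2)// ?nnegrE// -!hdot_norm tensor2_sum_dot (bigD1 j)//= lerDl.
by apply: sumr_ge0 => k _; apply: dot_ge0.
Qed.

Lemma tensor2_norm_basis j y : `|b (e j) y| = `|y|.
Proof.
apply/eqP; rewrite -(@eqrXn2 _ 2)//; apply/eqP.
by rewrite -!hdot_norm (htensor2_dot hb) be.1 eqxx mul1r.
Qed.

Lemma tensor2_span k (c : 'I_k -> R[i]) (x : 'I_k -> W) (y : 'I_k -> K) :
  exists g : J -> K, \sum_m c m *: b (x m) (y m) = \sum_j b (e j) (g j).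
Proof.
exists (fun j => \sum_m (c m * '[x m, e j]) *: y m).
transitivity (\sum_m \sum_j b (e j) ((c m * '[x m, e j]) *: y m)).
  apply: eq_bigr => m _; rewrite {1}(be.2 (x m)) linear_sumlz scaler_sumr.
  by apply: eq_bigr => j _; rewrite linearZl_LR/= linearZr_LR/= scalerA.
by rewrite exchange_big; apply: eq_bigr => j _; rewrite linear_sumr.
Qed.

(* The vectors [\sum_j b (e j) (g j)] form a closed subspace, being isometric to
   a finite power of the complete space [K]. *)
Lemma tensor2_expansion (xi : T) : exists g : J -> K, xi = \sum_j b (e j) (g j).
Proof.
have approx (m : nat) : exists g : J -> K, `|xi - \sum_j b (e j) (g j)| < m.+1%:R^-1.
  have [|z [k [c [x [y ->]]]] xz] :=
    dense_approx xi (htensor2_dense hb) (_ : 0 < m.+1%:R^-1).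
    by rewrite invr_gt0.
  by have [g gE] := tensor2_span c x y; exists g; rewrite -gE.
have [G GE] := choice approx.
have subE (g h : J -> K) : \sum_j b (e j) (g j) - \sum_j b (e j) (h j) =
    \sum_j b (e j) (g j - h j).
  by rewrite -sumrB; apply: eq_bigr => j _; rewrite linearBr.
have Gnear (eps : R[i]) : 0 < eps -> exists N, forall m, (N <= m)%N ->
    `|xi - \sum_j b (e j) (G m j)| < eps.
  move=> /complex_invS_lt[N Neps]; exists N => m Nm.
  apply: lt_le_trans (GE m) (le_trans _ (ltW Neps)).
  by rewrite lef_pV2 ?posrE// ler_nat.
(* The approximating sums are Cauchy and their norm dominates that of each coefficient, so the
   coefficients converge in [K]. *)
have Gcvg j : cvg ((fun m => G m j) @ \oo).
  apply: cauchy_cvg; apply: cauchy_exP => eps eps0.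
  have [N NE] := Gnear (eps / 2) (divr_gt0 eps0 (ltr0n _ 2)).
  exists (G N j); exists N => // m /= Nm; rewrite -ball_normE /=.
  apply: le_lt_trans (tensor2_coef_le (fun j => G N j - G m j) j) _.
  rewrite -subE; rewrite (splitr eps).
  apply: le_lt_trans (ler_distD xi _ _) _.
  by apply: ltrD; rewrite ?NE// distrC NE.
pose g j := lim ((fun m => G m j) @ \oo); exists g.
apply: contrapT => /eqP; rewrite -subr_eq0 -normr_gt0.
(* One share of [y] for the distance from [xi] to an approximating sum, and one for each
   coefficient; strictness in the first gives [y < y]. *)
set y := `|_| => y0; pose eps := y / #|J|.+1%:R.
have eps0 : 0 < eps by rewrite divr_gt0.
have gN : \forall m \near \oo, forall j, `|g j - G m j| < eps.
  apply: filter_forall => j; exact: (cvgrPdist_lt _ _).1 (Gcvg j) eps eps0.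
have xN : \forall m \near \oo, `|xi - \sum_j b (e j) (G m j)| < eps.
  by have [N NE] := Gnear eps eps0; exists N.
have [m [gE xE]] := filter_ex (filterI gN xN).
suff : y < y by rewrite ltxx.
apply: le_lt_trans (ler_distD (\sum_j b (e j) (G m j)) _ _) _.
have -> : y = eps + \sum_(j in J) eps.
  by rewrite sumr_const -mulrS -mulr_natr divfK// pnatr_eq0.
apply: ltr_leD => //; rewrite subE; apply: le_trans (ler_norm_sum _ _ _) _.
by apply: ler_sum => j _; rewrite tensor2_norm_basis distrC ltW.
Qed.

End Basis.

Section Slice.
Variables (k : nat) (e0 : 'I_k -> W) (be0 : onb e0) (xi : T).

(** The expansion of [xi] along [e0] yields [S] by an explicit formula, in place of a Riesz
    representation argument. *)
Lemma slice_exists : exists S : W -> K, forall w y, '[xi, b w y] = '[S w, y].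
Proof.
have [g ->] := tensor2_expansion be0 xi.
exists (fun w => \sum_j '[e0 j, w] *: g j) => w y.
rewrite !dot_suml; apply: eq_bigr => j _.
by rewrite (htensor2_dot hb) dotZl.
Qed.

Variables (S : W -> K) (SE : forall w y, '[xi, b w y] = '[S w, y]).

Lemma slice_conjlinear c u v : S (c *: u + v) = c^* *: S u + S v.
Proof.
apply: dot_inj => y; rewrite -SE linearDl linearZl_LR/= !dotE.
by rewrite !SE.
Qed.

Lemma slice0 : S 0 = 0.
Proof. by apply: dot_inj => y; rewrite -SE linear0l dot0r dot0l. Qed.

Lemma sliceZ c u : S (c *: u) = c^* *: S u.
Proof. by rewrite -[c *: u]addr0 slice_conjlinear slice0 addr0. Qed.

Lemma slice_basis (J : finType) (e : J -> W) (g : J -> K) : onb e ->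
  xi = \sum_j b (e j) (g j) -> forall j, S (e j) = g j.
Proof.
move=> be xiE j; apply: dot_inj => y; rewrite -SE xiE dot_suml (bigD1 j)//= big1.
  by rewrite (htensor2_dot hb) be.1 eqxx mul1r addr0.
by move=> l lj; rewrite (htensor2_dot hb) be.1 (negbTE lj) mul0r.
Qed.

Lemma slice_expansion (J : finType) (e : J -> W) : onb e ->
  xi = \sum_j b (e j) (S (e j)).
Proof.
move=> be; have [g xiE] := tensor2_expansion be xi.
by rewrite {1}xiE; apply: eq_bigr => j _; rewrite (slice_basis be xiE).
Qed.

Lemma slice_dot (J : finType) (e : J -> W) : onb e ->
  '[xi, xi] = \sum_j '[S (e j), S (e j)].
Proof. by move=> be; rewrite {1 2}(slice_expansion be) tensor2_sum_dot. Qed.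

End Slice.

End Tensor2.

(** * Bounded operators on tensor products *)

Section BoundedOperators.
Variable R : realType.
Implicit Types H K W T : hilbertType R.

Lemma bounded_operator_intro H K (A : H -> K) (M : R[i]) : linear A -> 0 <= M ->
  (forall x, `|A x| <= M * `|x|) -> bounded_operator A.
Proof.
move=> lA M0 AM; split=> //; exists (complex.Re M) => x.
by rewrite -lecR rmorphM/= !hnormE RRe_real// ger0_real.
Qed.

Lemma bounded_operator_norm H K (A : H -> K) : bounded_operator A ->
  exists2 M : R[i], 0 <= M & forall x, `|A x| <= M * `|x|.
Proof.
case=> _ [M AM]; exists (`|M|)%:C%C => [|x]; first by rewrite ler0c.
rewrite -!hnormE -rmorphM lecR; apply: le_trans (AM x) _.
by rewrite ler_wpM2r ?hnorm_ge0 ?ler_norm.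
Qed.

(** Bessel for the single vector [u]. These operators later test the tracial identity. *)
Lemma rank_one_bounded H K (u : H) (v : K) : '[u, u] = 1 ->
  bounded_operator (fun x => '[x, u] *: v).
Proof.
move=> u1; apply: (@bounded_operator_intro _ _ _ `|v|) => // [c x y|x].
  by rewrite dotDl dotZl scalerDl scalerA.
rewrite normrZ mulrC ler_wpM2l// -(@ler_pXn2r _ 2)// ?nnegrE// -hdot_norm.
have oe : orthonormal_on (fun _ : 'I_1 => u) by move=> i j; rewrite !ord1 u1.
have := dot_ge0 (x - \sum_(i < 1) '[x, u] *: u).
by rewrite (bessel_id x oe) big_ord1 subr_ge0 [in '[u, x]]dotC -normCK.
Qed.

Lemma Re_dot_unit_le H (x y : H) : hnorm y = 1 -> complex.Re '[x, y] <= hnorm x.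
Proof.
move=> /hnorm1P y1; have [x0|x0] := eqVneq (hnorm x) 0.
  by rewrite x0 [x]dot_eq0 ?dot0l// -hnorm_sq x0 expr0n.
have xgt0 : 0 < hnorm x by rewrite lt_neqAle eq_sym x0 hnorm_ge0.
(* This square equals 2 |x|^2 - 2 |x| Re <x, y>, and |x| > 0 can be cancelled. *)
have := sqr_ge0 (hnorm (x - (hnorm x)%:C%C *: y)).
have conjr : ((hnorm x)%:C%C)^* = (hnorm x)%:C%C :> R[i].
  by apply/CrealP; rewrite ger0_real// hnormE.
rewrite -Re_dot !dotE conjr y1 -[in '[x, x]]hnorm_sq [in '[y, x]]dotC.
case: '[x, y] => a b /=; nra.
Qed.

Section TensorOperators.
Variables (W K T : hilbertType R) (b : {bilinear W -> K -> T}).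
Hypothesis hb : hilbert_tensor2 b.
Variables (k : nat) (e : 'I_k -> W) (be : onb e).

(** The operator sends sum_j e_j (x) g_j to sum_j A e_j (x) B g_j. Its existence ensures that [xget]
    in [tensor_op] and [tensor2_op] does not return its default value. *)
Lemma tensor2_operator (A : W -> W) (B : K -> K) : linear A -> bounded_operator B ->
  exists C : T -> T, bounded_operator C /\ forall x y, C (b x y) = b (A x) (B y).
Proof.
move=> lA bB; have lB := bB.1.
have [g gE] := choice (tensor2_expansion hb be).
have gdot z j y : '[g z j, y] = '[z, b (e j) y].
  rewrite {2}(gE z) dot_suml (bigD1 j)//= big1.
    by rewrite (htensor2_dot hb) be.1 eqxx mul1r addr0.
  by move=> l lj; rewrite (htensor2_dot hb) be.1 (negbTE lj) mul0r.
have gl j : linear (fun z => g z j).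
  by move=> c u v; apply: dot_inj => y; rewrite dotDl dotZl !gdot dotDl dotZl.
have [M M0 BM] := bounded_operator_norm bB.
exists (fun z => \sum_j b (A (e j)) (B (g z j))); split.
  apply: (@bounded_operator_intro _ _ _ (\sum_j `|A (e j)| * M)).
  - move=> c u v; rewrite scaler_sumr -big_split; apply: eq_bigr => j _ /=.
    by rewrite (gl j) lB linearDr linearZr_LR.
  - by apply: sumr_ge0 => j _; rewrite mulr_ge0.
  move=> z; rewrite mulr_suml; apply: le_trans (ler_norm_sum _ _ _) _.
  apply: ler_sum => j _.
  have -> : `|b (A (e j)) (B (g z j))| = `|A (e j)| * `|B (g z j)|.
    apply/eqP; rewrite -(@eqrXn2 _ 2)// ?mulr_ge0//; apply/eqP.
    by rewrite exprMn -!hdot_norm (htensor2_dot hb).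
  rewrite -mulrA ler_wpM2l//; apply: le_trans (BM _) _; rewrite ler_wpM2l//.
  by rewrite {2}(gE z); apply: (tensor2_coef_le hb be).
move=> x y /=.
have gb j : g (b x y) j = '[x, e j] *: y.
  by apply: dot_inj => z; rewrite gdot dotZl (htensor2_dot hb).
rewrite {2}(be.2 x) (linear_prop_sum _ lA) linear_sumlz; apply: eq_bigr => j _.
by rewrite gb (linear_propZ lA) (linear_propZ lB) linearZl_LR linearZr_LR.
Qed.

End TensorOperators.
End BoundedOperators.

(** * Maximal vectors *)

Section Distance.
Variables (R : realType) (T : hilbertType R) (V : set T) (s : R).
Hypotheses (V1 : forall v, V v -> hnorm v = 1) (V0 : V !=set0).

Let d := Num.sqrt (2 - 2 * s).

Lemma dist_le_overlap xi v : hnorm xi = 1 -> V v ->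
  s <= complex.Re '[xi, v] -> dist xi V <= d.
Proof.
move=> xi1 Vv sv; apply: le_trans (_ : hnorm (xi - v) <= d).
  by apply: ge_inf; [exists 0 => _ [w _ <-]; exact: hnorm_ge0 | exists v].
rewrite -[leLHS]ger0_norm ?hnorm_ge0// -sqrtr_sqr ler_wsqrtr// hnormB_unit ?(V1 Vv)//.
lra.
Qed.

Lemma dist_ge_overlap xi : hnorm xi = 1 ->
  d <= dist xi V <-> forall v, V v -> complex.Re '[xi, v] <= s.
Proof.
move=> xi1; split=> [dle v Vv|le_s].
  have : d <= hnorm (xi - v).
    apply: le_trans dle _.
    by apply: ge_inf; [exists 0 => _ [w _ <-]; exact: hnorm_ge0 | exists v].
  rewrite -[leRHS]ger0_norm ?hnorm_ge0// -sqrtr_sqr ler_sqrt ?sqr_ge0//.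
  by rewrite hnormB_unit ?(V1 Vv)//; lra.
apply: lb_le_inf; first by have [v Vv] := V0; exists (hnorm (xi - v)), v.
move=> _ [v Vv <-]; rewrite -[leRHS]ger0_norm ?hnorm_ge0// -sqrtr_sqr ler_wsqrtr//.
by rewrite hnormB_unit ?(V1 Vv)//; have := le_s v Vv; lra.
Qed.

(** The first hypothesis bounds all distances by [d], the second provides a vector at distance [d];
    hence the supremum in [maximal_vector] is [d]. *)
Lemma maximal_vector_overlap :
  (forall xi, hnorm xi = 1 -> exists2 v, V v & s <= complex.Re '[xi, v]) ->
  (exists2 xi, hnorm xi = 1 & forall v, V v -> complex.Re '[xi, v] <= s) ->
  forall xi, maximal_vector V xi <->
    hnorm xi = 1 /\ forall v, V v -> complex.Re '[xi, v] <= s.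
Proof.
move=> attained [xi0 xi01 xi0s].
have dist_le y : hnorm y = 1 -> dist y V <= d.
  by move=> y1; have [v Vv] := attained y y1; exact: dist_le_overlap.
have supE : sup [set dist y V | y in [set y : T | hnorm y = 1]] = d.
  apply/eqP; rewrite eq_le; apply/andP; split.
    apply: ge_sup; first by exists (dist xi0 V), xi0.
    by move=> _ [y y1 <-]; exact: dist_le.
  apply: le_trans (_ : dist xi0 V <= _); first exact/dist_ge_overlap.
  by apply: ub_le_sup; [exists d => _ [y y1 <-]; exact: dist_le | exists xi0].
move=> xi; rewrite /maximal_vector supE; split=> -[xi1 xiE]; split=> //.
  by apply/dist_ge_overlap => //; rewrite xiE.
by apply/eqP; rewrite eq_le dist_le//; apply/dist_ge_overlap.
Qed.

End Distance.

(** The types vary with the index, so values are transported along the equation given by [unliftP];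
    axiom K for ordinals removes the transports. *)
Lemma lift_max_family (M : nat) (F : 'I_M.+1 -> Type)
    (x' : forall i : 'I_M, F (lift ord_max i)) (y : F ord_max) :
  exists x : forall i, F i, (forall i, x (lift ord_max i) = x' i) /\ x ord_max = y.
Proof.
exists (fun i => match unliftP ord_max i with
  | UnliftSome j E => ecast i (F i) (esym E) (x' j)
  | UnliftNone E => ecast i (F i) (esym E) y end).
split=> [i|]; case: unliftP => [j E|E].
- by have ij := lift_inj E; case: _ / ij E => E; rewrite eq_axiomK.
- by exfalso; move: (neq_lift ord_max i); rewrite E eqxx.
- by exfalso; move: (neq_lift ord_max j); rewrite -E eqxx.
- by rewrite eq_axiomK.
Qed.

Lemma onb_dim_gt0 (R : realType) (H : hilbertType R) k (e : 'I_k -> H) (x : H) :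
  onb e -> x != 0 -> (0 < k)%N.
Proof.
case: k e => // e [_ se] /eqP []; by rewrite (se x) big_ord0.
Qed.

(** * Orthonormal bases of decomposable vectors *)

Section ProductBasis.
Variables (R : realType) (M : nat) (H : 'I_M -> hilbertType R) (T : hilbertType R).
Variables (t : (forall i, H i) -> T) (ht : hilbert_tensor t) (n : 'I_M -> nat).
Hypothesis H_dim : forall i, has_dim (H i) (Some (n i)).
Let p := (\prod_(i < M) n i)%N.

Lemma product_basis_through (x : forall i, H i) : (forall i, '[x i, x i] = 1) ->
  exists E : 'I_p -> forall i, H i,
    [/\ onb (t \o E), forall k i, '[E k i, E k i] = 1 & exists k, E k = x].
Proof.
move=> x1.
have ex i : exists ej : ('I_(n i) -> H i) * 'I_(n i), onb ej.1 /\ ej.1 ej.2 = x i.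
  have [e /orthonormal_basisP be] := H_dim i.
  have n0 : (0 < n i)%N.
    apply: (onb_dim_gt0 (x := x i) be); apply/eqP => xi0.
    by have := x1 i; rewrite xi0 dot0l => /esym/eqP; rewrite oner_eq0.
  (* Each factor gets a basis containing [x i], so the product basis contains [t x]. *)
  have [e' be' e'x] := onb_through_unit (Ordinal n0) be (x1 i).
  by exists (e', Ordinal n0).
pose e i := (projT1 (cid (ex i))).1; pose j i := (projT1 (cid (ex i))).2.
have be i : onb (e i) by rewrite /e; case: cid => ? [].
have ej i : e i (j i) = x i by rewrite /e /j; case: cid => ? [].
have card_p : p = #|fprod (fun i => 'I_(n i) : finType)|.
  by rewrite card_fprod; apply: eq_bigr => i _; rewrite card_ord.
pose h (k : 'I_p) : fprod (fun i => 'I_(n i) : finType) := enum_val (cast_ord card_p k).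
have hb : bijective h.
  exists (fun phi => cast_ord (esym card_p) (enum_rank phi)) => k.
    by rewrite /h enum_valK cast_ordK.
  by rewrite /h cast_ordKV enum_rankK.
exists (fun k i => e i (h k i)); split.
- exact: (onb_reindex hb (onb_tensor ht be)).
- by move=> k i; rewrite (be i).1 eqxx.
- have [h' _ h'K] := hb; exists (h' [fprod i => j i]); rewrite h'K.
  by apply: functional_extensionality_dep => i; rewrite fprodE.
Qed.

End ProductBasis.

Section MaximalVectors.
Variables (R : realType) (M : nat) (H : 'I_M.+1 -> hilbertType R).
Hypothesis H_nonzero : forall i, exists x : H i, x != 0.
Variables (n : 'I_M -> nat).
Hypothesis H_dim : forall i : 'I_M, has_dim (H (lift ord_max i)) (Some (n i)).
Variables (T' T : hilbertType R) (t' : (forall i : 'I_M, H (lift ord_max i)) -> T').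
Variables (t : (forall i : 'I_M.+1, H i) -> T) (b : {bilinear T' -> H ord_max -> T}).
Hypotheses (ht' : hilbert_tensor t') (ht : hilbert_tensor t) (hb : hilbert_tensor2 b).
Hypothesis t_assoc : forall x : (forall i, H i),
  t x = b (t' (fun i => x (lift ord_max i))) (x ord_max).

Let p := (\prod_(i < M) n i)%N.
Let V := decomposable_unit t.
Let K := H ord_max.
Let s : R := (Num.sqrt p%:R)^-1.

Lemma unit_exists i : exists x : H i, '[x, x] = 1.
Proof. by have [x x0] := H_nonzero i; exists (`|x|^-1 *: x); exact: dot_normalized. Qed.

Let x0 i : H i := projT1 (cid (unit_exists i)).
Let x0_unit i : '[x0 i, x0 i] = 1.
Proof. by rewrite /x0; case: cid. Qed.

Lemma product_basis : exists E : 'I_p -> forall i, H (lift ord_max i),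
  onb (t' \o E) /\ forall k i, '[E k i, E k i] = 1.
Proof.
have [E [bE E1 _]] := product_basis_through ht' H_dim (fun i => x0_unit (lift ord_max i)).
by exists E.
Qed.

Lemma p_gt0 : (0 < p)%N.
Proof.
rewrite prodn_cond_gt0// => i _; have [e /orthonormal_basisP be] := H_dim i.
by have [x] := H_nonzero (lift ord_max i); exact: onb_dim_gt0 be.
Qed.

Let p_neq0 : p%:R != 0 :> R[i].
Proof. by rewrite pnatr_eq0 -lt0n p_gt0. Qed.

Let s_gt0 : 0 < s.
Proof. by rewrite invr_gt0 sqrtr_gt0 ltr0n p_gt0. Qed.

Let s_sq : (s ^+ 2)%:C%C = p%:R^-1 :> R[i].
Proof.
by rewrite exprVn sqr_sqrtr ?ler0n// fmorphV/= rmorph_nat.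
Qed.

Let sum_invp : \sum_(k < p) p%:R^-1 = 1 :> R[i].
Proof. by rewrite sumr_const card_ord -[LHS]mulr_natl divff. Qed.

Lemma t_split (x' : forall i, H (lift ord_max i)) (y : K) :
  exists x : forall i, H i,
    [/\ t x = b (t' x') y, forall i, x (lift ord_max i) = x' i & x ord_max = y].
Proof.
have [x [xl xm]] := @lift_max_family M (fun i => H i) x' y; exists x; split => //.
rewrite t_assoc xm; congr (b (t' _) _).
exact: functional_extensionality_dep.
Qed.

Lemma decomposable_intro (x' : forall i, H (lift ord_max i)) (y : K) :
  (forall i, '[x' i, x' i] = 1) -> '[y, y] = 1 -> V (b (t' x') y).
Proof.
move=> x'1 y1; have [x [<- xl xm]] := t_split x' y; exists x => // i.
apply/hnorm1P; case: (unliftP ord_max i) => [j|] ->; last by rewrite xm.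
by rewrite xl.
Qed.

Lemma decomposable_hnorm v : V v -> hnorm v = 1.
Proof. by case=> x x1 <-; apply/hnorm1P/(tensor_unit ht) => i; apply/hnorm1P/x1. Qed.

Lemma decomposable_neq0 : V !=set0.
Proof. by exists (t x0), x0 => // i; apply/hnorm1P. Qed.

(** * Overlaps of a vector with decomposable unit vectors *)

Section Vector.
Variables (xi : T) (S : T' -> K) (SE : forall w y, '[xi, b w y] = '[S w, y]).

(** Equality in Cauchy-Schwarz: the last factor is the normalized [S (t' x')], or any unit vector if
    this vanishes. *)
Lemma slice_attained (x' : forall i, H (lift ord_max i)) :
  (forall i, '[x' i, x' i] = 1) ->
  exists2 v, V v & complex.Re '[xi, v] = hnorm (S (t' x')).
Proof.
move=> x'1; have [S0|S0] := eqVneq (S (t' x')) 0.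
  exists (b (t' x') (x0 ord_max)); first exact: (decomposable_intro x'1 (x0_unit _)).
  by rewrite SE S0 dot0l /hnorm normr0.
exists (b (t' x') (`|S (t' x')|^-1 *: S (t' x'))).
  by apply: decomposable_intro => //; exact: dot_normalized.
rewrite SE dotZr hdot_norm.
have -> : (`|S (t' x')|^-1)^* = `|S (t' x')|^-1 by apply/CrealP; rewrite rpredV ger0_real.
by rewrite expr2 mulrA mulVf ?mul1r// normr_eq0.
Qed.

Lemma overlap_le (r : R) :
  (forall x', (forall i, '[x' i, x' i] = 1) -> hnorm (S (t' x')) <= r) ->
  forall v, V v -> complex.Re '[xi, v] <= r.
Proof.
move=> Sr _ [x x1 <-]; rewrite t_assoc SE.
apply: le_trans (Sr (fun i => x (lift ord_max i)) _).
  by apply: Re_dot_unit_le; exact: x1.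
by move=> i; apply/hnorm1P; exact: x1.
Qed.

Lemma slice_sq_le (x' : forall i, H (lift ord_max i)) :
  (hnorm (S (t' x')) <= s) = ('[S (t' x'), S (t' x')] <= p%:R^-1).
Proof.
by rewrite -s_sq -hnorm_sq lecR ler_pXn2r// nnegrE ?hnorm_ge0// ltW.
Qed.

Lemma overlap_attained : hnorm xi = 1 -> exists2 v, V v & s <= complex.Re '[xi, v].
Proof.
move=> /hnorm1P xi1; have [E [bE E1]] := product_basis.
suff [k Sk] : exists k, s <= hnorm (S (t' (E k))).
  by have [v Vv vE] := slice_attained (E1 k); exists v; rewrite ?vE.
apply: contrapT => /forallNP small.
have small' k : hnorm (S (t' (E k))) ^+ 2 < s ^+ 2.
  by rewrite ltr_pXn2r ?nnegrE ?hnorm_ge0 ?(ltW s_gt0)// ltNge; apply/negP/small.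
have : '[xi, xi] < \sum_(k < p) p%:R^-1.
  rewrite (slice_dot hb SE bE).
  apply: ltr_sum => [|k _].
    (* A sum of strict inequalities is strict only if it is nonempty, whence [p_gt0]. *)
    by apply/hasP; exists (Ordinal p_gt0); rewrite ?mem_index_enum.
  by rewrite /= -s_sq -hnorm_sq ltcR.
by rewrite xi1 sum_invp ltxx.
Qed.

(* [w] and [w'] are exchanged because [S] is conjugate linear. *)
Definition slice_isometry := forall w w', '[S w', S w] = p%:R^-1 * '[w, w'].

(** The defect of isometry, a sesquilinear form to which polarization applies. *)
Let Q w w' := '[S w', S w] - p%:R^-1 * '[w, w'].

Let Ql c u v w : Q (c *: u + v) w = c * Q u w + Q v w.
Proof. by rewrite /Q (slice_conjlinear SE) !dotE conjCK; ring. Qed.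

Let Qr c u v w : Q w (c *: u + v) = c^* * Q w u + Q w v.
Proof. by rewrite /Q (slice_conjlinear SE) !dotE; ring. Qed.

Lemma slice_isometry_basis (J : finType) (e : J -> T') : onb e ->
  (forall j k, '[S (e k), S (e j)] = p%:R^-1 * (j == k)%:R) -> slice_isometry.
Proof.
move=> be Se w w'; apply/eqP; rewrite -subr_eq0; apply/eqP; rewrite -/(Q w w').
have Qe j k : Q (e j) (e k) = 0 by rewrite /Q Se be.1 subrr.
have Q0r u : Q u 0 = 0 by rewrite /Q (slice0 SE) dot0l dot0r mulr0 subrr.
have Q0l u : Q 0 u = 0 by rewrite /Q (slice0 SE) dot0l dot0r mulr0 subrr.
have Qew j : Q (e j) w' = 0.
  rewrite (be.2 w'); elim/big_ind: _ => [|u v Qu Qv|k _]; first exact: Q0r.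
    by rewrite -[u]scale1r Qr rmorph1 mul1r Qu Qv addr0.
  by rewrite -[X in Q _ X]addr0 Qr Q0r addr0 Qe mulr0.
rewrite (be.2 w); elim/big_ind: _ => [|u v Qu Qv|j _]; first exact: Q0l.
  by rewrite -[u]scale1r Ql mul1r Qu Qv addr0.
by rewrite -[X in Q X]addr0 Ql Q0l addr0 Qew mulr0.
Qed.

Lemma slice_isometry_overlap : slice_isometry ->
  forall v, V v -> complex.Re '[xi, v] <= s.
Proof.
move=> Siso; apply: overlap_le => x' x'1.
by rewrite slice_sq_le Siso (tensor_unit ht' x'1) mulr1.
Qed.

Lemma slice_isometry_unit : slice_isometry -> hnorm xi = 1.
Proof.
move=> Siso; apply/hnorm1P; have [E [bE E1]] := product_basis.
rewrite (slice_dot hb SE bE) (eq_bigr (fun=> p%:R^-1)) => [|k _].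
  exact: sum_invp.
by rewrite Siso bE.1 eqxx mulr1.
Qed.

Lemma overlap_slice_isometry : hnorm xi = 1 ->
  (forall v, V v -> complex.Re '[xi, v] <= s) -> slice_isometry.
Proof.
move=> /hnorm1P xi1 xis.
have S_le x' : (forall i, '[x' i, x' i] = 1) -> '[S (t' x'), S (t' x')] <= p%:R^-1.
  by move=> x'1; have [v /xis] := slice_attained x'1; rewrite -slice_sq_le => /[swap] ->.
(* Along a decomposable basis through [t' x'] the numbers 1/p - |S e_k|^2 are nonnegative and add up
   to 1 - |xi|^2 = 0, so all vanish. *)
have S_eq x' : (forall i, '[x' i, x' i] = 1) -> '[S (t' x'), S (t' x')] = p%:R^-1.
  move=> x'1; have [E [bE E1 [k <-]]] := product_basis_through ht' H_dim x'1.
  have sum0 : \sum_(k < p) (p%:R^-1 - '[S (t' (E k)), S (t' (E k))]) = 0.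
    by rewrite sumrB sum_invp -(slice_dot hb SE bE) xi1 subrr.
  apply/esym/eqP; rewrite -subr_eq0; apply/eqP.
  apply: (psumr_eq0P _ sum0) => // j _.
  by rewrite subr_ge0 S_le.
(* From unit factors to arbitrary ones: a zero factor kills [t' x], and otherwise the factors are
   normalized. *)
have Qt x : Q (t' x) (t' x) = 0.
  have [[i xi0]|nz] := pselect (exists i, x i = 0).
    have tx0 : t' x = 0.
      by apply: dot_eq0; rewrite (htensor_dot ht') (bigD1 i)//= xi0 dot0l mul0r.
    by rewrite tx0 /Q (slice0 SE) !dot0l mulr0 subr0.
  have nz' i : x i != 0 by apply/eqP => xi0; apply: nz; exists i.
  pose x' i := `|x i|^-1 *: x i.
  have x'1 i : '[x' i, x' i] = 1 by exact: dot_normalized.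
  have -> : x = fun i => `|x i| *: x' i.
    apply: functional_extensionality_dep => i.
    by rewrite scalerA divff ?scale1r ?normr_eq0 ?nz'.
  rewrite (tensor_scale ht') /Q (sliceZ SE) !(dotZl, dotZr) conjCK S_eq//.
  by rewrite (tensor_unit ht' x'1); ring.
have [E [bE E1]] := product_basis; apply: (slice_isometry_basis bE) => j k.
apply/eqP; rewrite -subr_eq0 -(bE.1 j k); apply/eqP.
exact: (tensor_polarization ht' Ql Qr Qt).
Qed.

End Vector.

(** * Entangled vectors and purification of the tracial state *)

Section Characterizations.
Variables (xi : T) (S : T' -> K) (SE : forall w y, '[xi, b w y] = '[S w, y]).

Let sqrtp_real (c := sqrtC (p%:R : R[i])) : c * c^* = p%:R.
Proof.
have -> : c^* = c by apply/CrealP; rewrite ger0_real// sqrtC_ge0 ler0n.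
by rewrite -expr2 sqrtCK.
Qed.

Let sqrtp_neq0 : sqrtC (p%:R : R[i]) != 0.
Proof. by rewrite sqrtC_eq0. Qed.

Lemma entangled_slice_isometry (e : 'I_p -> T') (f : 'I_p -> K) : onb e ->
  orthonormal_family f -> xi = (sqrtC p%:R)^-1 *: \sum_(k < p) b (e k) (f k) ->
  slice_isometry S.
Proof.
move=> be of_ xiE; apply: (slice_isometry_basis SE be) => j k.
have Se := slice_basis hb SE (g := fun k => (sqrtC p%:R)^-1 *: f k) be.
rewrite !Se; last 2 first.
- by rewrite xiE scaler_sumr; apply: eq_bigr => l _; rewrite linearZr_LR.
- by rewrite xiE scaler_sumr; apply: eq_bigr => l _; rewrite linearZr_LR.
by rewrite dotZl dotZr of_ mulrA fmorphV/= -invfM sqrtp_real eq_sym.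
Qed.

Lemma slice_isometry_orthonormal (e : 'I_p -> T') : onb e -> slice_isometry S ->
  orthonormal_family (fun k => sqrtC p%:R *: S (e k)).
Proof.
move=> be Siso j k; rewrite dotZl dotZr mulrA sqrtp_real Siso be.1 mulrA divff// mul1r.
by rewrite eq_sym.
Qed.

Lemma slice_isometry_entangled (e : 'I_p -> T') : onb e ->
  xi = (sqrtC p%:R)^-1 *: \sum_(k < p) b (e k) (sqrtC p%:R *: S (e k)).
Proof.
move=> be; rewrite {1}(slice_expansion hb SE be) scaler_sumr; apply: eq_bigr => k _.
by rewrite linearZr_LR/= scalerA mulVf// scale1r.
Qed.

Lemma tensor2_op_dot (A : T' -> T') (e : 'I_p -> T') : onb e -> bounded_operator A ->
  '[tensor2_op b A idfun xi, xi] = \sum_k '[S (e k), S (A (e k))].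
Proof.
move=> be bA; have bid : bounded_operator (@idfun K) := (unitary_id K).1.
have [[lC _] CE] := xgetPex (fun=> 0) (tensor2_operator hb be bA.1 bid).
rewrite /tensor2_op; move: (xget _ _) lC CE => C lC CE.
rewrite {1}(slice_expansion hb SE be) (linear_prop_sum _ lC) dot_suml.
by apply: eq_bigr => k _; rewrite CE dotC SE -dotC.
Qed.

Lemma slice_isometry_tracial : slice_isometry S <->
  forall A : T' -> T', bounded_operator A ->
    trace A / p%:R = '[tensor2_op b A idfun xi, xi].
Proof.
have [E [be _]] := product_basis; set e := t' \o E in be.
split=> [Siso A bA|tauE].
  rewrite (trace_onb be bA.1) (tensor2_op_dot be bA) mulrC mulr_sumr.
  by apply: eq_bigr => k _; rewrite Siso.
apply: (slice_isometry_basis SE be) => j k.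
have ek1 : '[e k, e k] = 1 by rewrite be.1 eqxx.
(* For the converse, the operator w -> <w, e_k> e_j isolates the single product <S e_k, S e_j>. *)
have bA := rank_one_bounded (e j) ek1.
have trA : \sum_l '['[e l, e k] *: e j, e l] = (j == k)%:R.
  rewrite (bigD1 k)//= big1 => [|l lk]; first by rewrite ek1 scale1r addr0 be.1.
  by rewrite be.1 (negbTE lk) scale0r dot0l.
have SA : \sum_l '[S (e l), S ('[e l, e k] *: e j)] = '[S (e k), S (e j)].
  rewrite (bigD1 k)//= big1 => [|l lk]; first by rewrite ek1 scale1r addr0.
  by rewrite be.1 (negbTE lk) scale0r (slice0 SE) dot0r.
by rewrite -SA -trA mulrC -(tensor2_op_dot be bA) -tauE// (trace_onb be bA.1).
Qed.

End Characterizations.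

(** The orthonormal family in [K], where the size of n_N enters, yields an entangled vector whose
    overlaps are at most 1/sqrt p; so the bound valid for all unit vectors is sharp. *)
Lemma maximal_slice_isometry (xi : T) (S : T' -> K) :
  (exists f : 'I_p -> K, orthonormal_family f) ->
  (forall w y, '[xi, b w y] = '[S w, y]) -> maximal_vector V xi <-> slice_isometry S.
Proof.
move=> [f of_] SE; have [E [be _]] := product_basis; set e := t' \o E in be.
have attained eta : hnorm eta = 1 -> exists2 v, V v & s <= complex.Re '[eta, v].
  by have [S' S'E] := slice_exists hb be eta; exact: overlap_attained S'E.
have extremal : exists2 eta, hnorm eta = 1 & forall v, V v -> complex.Re '[eta, v] <= s.
  pose eta := (sqrtC p%:R)^-1 *: \sum_(k < p) b (e k) (f k).
  have [S' S'E] := slice_exists hb be eta.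
  have S'iso := entangled_slice_isometry S'E be of_ erefl.
  by exists eta; [exact: slice_isometry_unit S'E S'iso | exact: slice_isometry_overlap].
have maxE :=
  maximal_vector_overlap decomposable_hnorm decomposable_neq0 attained extremal xi.
split=> [/maxE[]|Siso]; first exact: overlap_slice_isometry.
by apply/maxE; split; [exact: slice_isometry_unit Siso | exact: slice_isometry_overlap].
Qed.

(** 1 (x) U acts term by term on xi1 = sum_k e_k (x) S1 e_k. The basis is decomposable because
    [tensor_op] is specified on decomposable vectors. *)
Lemma tensor_op_last (U : K -> K) (xi1 xi2 : T) (S1 S2 : T' -> K)
    (E : 'I_p -> forall i, H (lift ord_max i)) :
  bounded_operator U -> onb (t' \o E) ->
  (forall w y, '[xi1, b w y] = '[S1 w, y]) -> (forall w y, '[xi2, b w y] = '[S2 w, y]) ->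
  (forall k, U (S1 (t' (E k))) = S2 (t' (E k))) ->
  xi2 = tensor_op t (dfwith (fun i => @idfun (H i)) ord_max U) xi1.
Proof.
move=> bU be S1E S2E US.
have Cex : exists C : T -> T, bounded_operator C /\ forall x, C (t x) =
    t (fun i => dfwith (fun i => @idfun (H i)) ord_max U i (x i)).
  have [C [bC CE]] := tensor2_operator hb be (unitary_linear (unitary_id T')) bU.
  exists C; split=> // x; rewrite !t_assoc CE dfwithin; congr (b (t' _) _).
  by apply: functional_extensionality_dep => i; rewrite dfwithout// neq_lift.
have [[lC _] CE] := xgetPex (fun=> 0) Cex.
rewrite /tensor_op; move: (xget _ _) lC CE => C lC CE.
rewrite (slice_expansion hb S1E be) (linear_prop_sum _ lC).
rewrite {1}(slice_expansion hb S2E be); apply: eq_bigr => k _ /=.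
have [x [<- xl xm]] := t_split (E k) (S1 (t' (E k))).
rewrite CE t_assoc dfwithin xm US; congr (b (t' _) _).
by apply: functional_extensionality_dep => i; rewrite dfwithout ?neq_lift// xl.
Qed.

End MaximalVectors.

(* The number of factors is N = M.+1; [lift ord_max] embeds the indices of
   the first N - 1 factors, and [ord_max] is the index of the last one.
   [T] is H_1 (x) ... (x) H_N, [T'] is H_1 (x) ... (x) H_(N-1), and [b] is the
   identification of [T] with T' (x) H_N. *)
Theorem theorem12p1 (R : realType) (M : nat) (hM : (0 < M)%N)
  (H : 'I_M.+1 -> hilbertType R)
  (H_nonzero : forall i, exists x : H i, x != 0)
  (n : 'I_M -> nat) (nN : option nat)
  (H_dim : forall i : 'I_M, has_dim (H (lift ord_max i)) (Some (n i)))
  (HN_dim : has_dim (H ord_max) nN)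
  (n_le : forall i j : 'I_M, (i <= j)%N -> (n i <= n j)%N)
  (n_le_nN : forall i : 'I_M, leq_dim (n i) nN)
  (T' T : hilbertType R)
  (t' : (forall i : 'I_M, H (lift ord_max i)) -> T')
  (t : (forall i : 'I_M.+1, H i) -> T)
  (b : {bilinear T' -> H ord_max -> T})
  (t'_tensor : hilbert_tensor t')
  (t_tensor : hilbert_tensor t)
  (b_tensor : hilbert_tensor2 b)
  (t_assoc : forall x : (forall i, H i),
     t x = b (t' (fun i => x (lift ord_max i))) (x ord_max))
  (nN_large : leq_dim (\prod_(i < M) n i) nN) :
  let p := (\prod_(i < M) n i)%N in
  let V := decomposable_unit t in
  let tau (A : T' -> T') : R[i] := trace A / p%:R in
  [/\ forall xi1 xi2 : T, maximal_vector V xi1 -> maximal_vector V xi2 ->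
        exists2 U : H ord_max -> H ord_max, unitary_operator U &
          xi2 = tensor_op t (dfwith (fun i => @idfun (H i)) ord_max U) xi1,
      forall xi : T, maximal_vector V xi <->
        hnorm xi = 1 /\
        forall A : T' -> T', bounded_operator A ->
          tau A = '[tensor2_op b A idfun xi, xi]
    & forall xi : T, maximal_vector V xi <->
        exists (e : 'I_p -> T') (f : 'I_p -> H ord_max),
          [/\ orthonormal_basis e, orthonormal_family f &
              xi = (sqrtC p%:R)^-1 *: \sum_(k < p) b (e k) (f k)]].
Proof.
move=> p V tau.
have dimK := orthonormal_family_dim HN_dim nN_large.
have [E [be _]] := product_basis H_nonzero H_dim t'_tensor; set e := t' \o E in be.
have slice := slice_exists b_tensor be.
have maxP xi S := maximal_slice_isometry (xi := xi) (S := S) H_nonzero H_dim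
  t'_tensor t_tensor b_tensor t_assoc dimK.
split=> [xi1 xi2 max1 max2|xi|xi].
- have [S1 S1E] := slice xi1; have [S2 S2E] := slice xi2.
  have of1 := slice_isometry_orthonormal H_nonzero H_dim be ((maxP _ _ S1E).1 max1).
  have of2 := slice_isometry_orthonormal H_nonzero H_dim be ((maxP _ _ S2E).1 max2).
  (* [U] takes sqrt p S1 e_k to sqrt p S2 e_k; the factor sqrt p is cancelled below. *)
  have [U uU Uf] := unitary_extension of1 of2; exists U => //.
  apply: (tensor_op_last b_tensor t_assoc uU.1 be S1E S2E) => k.
  have p0 : sqrtC (p%:R : R[i]) != 0.
    by rewrite sqrtC_eq0 pnatr_eq0 -lt0n (p_gt0 H_nonzero H_dim).
  apply: (scalerI p0); rewrite -(linear_propZ (unitary_linear uU)).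
  exact: Uf.
- have [S SE] := slice xi.
  have traceP := slice_isometry_tracial H_nonzero H_dim t'_tensor b_tensor SE.
  split=> [maxi|[_ tauE]]; last exact/(maxP _ _ SE)/traceP.
  by split; [case: maxi | apply/traceP/(maxP _ _ SE)].
- have [S SE] := slice xi; split=> [/(maxP _ _ SE) Siso|[e' [f [be' of_ xiE]]]].
    exists e, (fun k => sqrtC p%:R *: S (e k)); split.
    + exact/orthonormal_basisP.
    + exact: slice_isometry_orthonormal.
    + exact: slice_isometry_entangled.
  apply/(maxP _ _ SE); apply: (entangled_slice_isometry b_tensor SE _ of_ xiE).
  exact/orthonormal_basisP.
Qed.
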